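(* Let $A\in\mathbb{R}^{n\times n}_+$ be a symmetric entrywise nonnegative matrix, and let $K$ be half the number of non-zero off-diagonal entries of $A$ (so $K\le \frac{n(n-1)}{2}$, with $K=\frac{n(n-1)}{2}$ when all off-diagonal entries of $A$ are positive). Then there exists an entrywise nonnegative matrix $H$ with $n$ rows and at most $K$ columns such that $$A_{ij}=(HH^T)_{ij}\qquad\text{for all } 1\le i,j\le n \text{ with } i\neq j .$$
   Context: A matrix with zero columns is allowed when $K=0$; in that case $HH^T$ is the zero matrix. The diagonal entries of $A$ and $HH^T$ are not required to agree. *)

(* Defs.v *)
From mathcomp Require Import all_boot all_order all_algebra.
From mathcomp Require Import reals.

Set Implicit Arguments.
Unset Strict Implicit.
Unset Printing Implicit Defensive.

Import Order.TTheory GRing.Theory Num.Theory.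

Local Open Scope ring_scope.

Definition nonneg_mx (R : realType) (m n : nat) (A : 'M[R]_(m, n)) : Prop :=
  forall i j, 0 <= A i j.

Definition symmetric_mx (R : realType) (n : nat) (A : 'M[R]_n) : Prop :=
  A^T = A.

(* Positions are ordered pairs: (i, j) and (j, i) are counted separately. *)
Definition offdiag_support (R : realType) (n : nat) (A : 'M[R]_n) :
    {set 'I_n * 'I_n} :=
  [set p | (p.1 != p.2) && (A p.1 p.2 != 0)].

(* The floor in ./2 is never active on a symmetric matrix:
   see double_half_offdiag. *)
Definition half_offdiag (R : realType) (n : nat) (A : 'M[R]_n) : nat :=
  #|offdiag_support A|./2.

Lemma double_half_offdiag (R : realType) (n : nat) (A : 'M[R]_n) :
  symmetric_mx A -> (half_offdiag A).*2 = #|offdiag_support A|.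
Proof.
move=> symA; pose S := offdiag_support A.
pose U := [set p : 'I_n * 'I_n | (p.1 < p.2)%N].
have inj : injective (fun p : 'I_n * 'I_n => (p.2, p.1)).
  by move=> [a b] [c d] [-> ->].
have cardS : #|S :\: U| = #|S :&: U|.
  rewrite -(card_imset _ inj); apply: eq_card => -[i j].
  apply/imsetP/idP => [[[a b]]|].
    rewrite !inE /= -leqNgt => /andP[le_ba /andP[ne_ab nzA]] [-> ->].
    by rewrite eq_sym ne_ab -{1}symA mxE nzA ltn_neqAle le_ba eq_sym /= andbT.
  rewrite !inE /= => /andP[/andP[ne_ij nzA] lt_ij]; exists (j, i) => //.
  by rewrite !inE /= -leqNgt (ltnW lt_ij) eq_sym ne_ij -symA mxE nzA.
by rewrite /half_offdiag -/S -(cardsID U S) cardS addnn doubleK.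
Qed.

(* Main.v *)
Require Import Defs.
From mathcomp Require Import all_boot all_order all_algebra.
From mathcomp Require Import reals.

(** Regard the nonzero off-diagonal entries of a symmetric [A] as the edges of
    a weighted graph on ['I_n]; half their number is the number of edges.  Give
    each edge [{a, b}] one column of [H], equal to [Num.sqrt (A a b)] at the
    rows [a] and [b] and to [0] elsewhere.  Its rank-one contribution to
    [H *m H^T] is [A a b] at the positions [(a, b)] and [(b, a)], and zero at
    every other off-diagonal position, so the contributions do not overlap off
    the diagonal ([edge_factor_mul]).  An edge is represented by its increasing
    pair, and each such pair accounts for two entries of the support
    ([card_edges_le]). *)

Set Implicit Arguments.
Unset Strict Implicit.
Unset Printing Implicit Defensive.

Import Order.TTheory GRing.Theory Num.Theory.

Local Open Scope ring_scope.

Lemma card_offdiag (n : nat) :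
  #|[set p : 'I_n * 'I_n | p.1 != p.2]| = (n * (n - 1))%N.
Proof.
have inj : injective (fun i : 'I_n => (i, i)) by move=> i j [].
have cardC : #|~: [set p : 'I_n * 'I_n | p.1 != p.2]| = n.
  rewrite -[RHS]card_ord -cardsT -(card_imset _ inj); apply: eq_card => -[i j].
  rewrite !inE /= negbK; apply/eqP/imsetP => [->|[k _ [-> ->]] //].
  by exists j.
have := cardsC [set p : 'I_n * 'I_n | p.1 != p.2].
by rewrite cardC card_prod card_ord mulnBr muln1 => <-; rewrite addnK.
Qed.

Lemma offdiag_support_sub (R : realType) (n : nat) (A : 'M[R]_n) :
  offdiag_support A \subset [set p | p.1 != p.2].
Proof. by apply/subsetP => p; rewrite !inE => /andP[]. Qed.

Definition edges (R : realType) (n : nat) (A : 'M[R]_n) : {set 'I_n * 'I_n} :=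
  [set p in offdiag_support A | (p.1 < p.2)%N].

(** The increasing pairs and their reversals are disjoint parts of the
    support of a symmetric matrix. *)
Lemma card_edges_le (R : realType) (n : nat) (A : 'M[R]_n) :
  symmetric_mx A -> (#|edges A| <= half_offdiag A)%N.
Proof.
move=> symA; rewrite -leq_double double_half_offdiag // -addnn.
pose swap (p : 'I_n * 'I_n) := (p.2, p.1).
have inj : injective swap by move=> [a b] [c d] [-> ->].
rewrite -{2}(card_imset _ inj) -cardsUI.
rewrite (_ : _ :&: _ = set0) ?cards0 ?addn0.
  apply/subset_leq_card/subsetP => p /setUP[|/imsetP[[a b]]].
    by rewrite inE => /andP[].
  rewrite !inE /= => /andP[/andP[neab nzA] _] -> /=.
  by rewrite eq_sym neab -symA mxE.
apply/setP => p; rewrite in_set0; apply/negP => /setIP[].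
rewrite inE => /andP[_ lt12] /imsetP[[a b]].
by rewrite inE => /andP[_ /= ltab] e; move: lt12; rewrite e ltnNge (ltnW ltab).
Qed.

(** The incidence matrix of the graph, with each column scaled by the square
    root of the weight of its edge. *)
Definition edge_factor (R : realType) (n : nat) (A : 'M[R]_n) :
    'M[R]_(n, #|edges A|) :=
  \matrix_(i, k) let e := enum_val k in
    if (i == e.1) || (i == e.2) then Num.sqrt (A e.1 e.2) else 0.

(** Increasing pairs represent two-element sets faithfully. *)
Lemma both_ends_eq (n : nat) (i j : 'I_n) (e : 'I_n * 'I_n) :
  (i < j)%N -> (e.1 < e.2)%N ->
  ((i == e.1) || (i == e.2)) && ((j == e.1) || (j == e.2)) = (e == (i, j)).
Proof.
case: e => a b /= ltij ltab; rewrite xpair_eqE; apply/andP/andP => -[].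
  move=> /orP[] /eqP ei /orP[] /eqP ej; move: ltij; rewrite ei ej ?ltnn //.
  by rewrite ltnNge (ltnW ltab).
by move=> /eqP -> /eqP ->; rewrite !eqxx orbT.
Qed.

(** Two distinct rows are both nonzero in a column only if they are the two
    ends of its edge, so at most one term of the product sum survives. *)
Lemma edge_factor_mul_lt (R : realType) (n : nat) (A : 'M[R]_n) (i j : 'I_n) :
  nonneg_mx A -> (i < j)%N ->
  A i j = (edge_factor A *m (edge_factor A)^T) i j.
Proof.
move=> A_ge0 ltij; have neij : i != j by rewrite neq_ltn ltij.
pose F (e : 'I_n * 'I_n) := if e == (i, j) then A i j else 0.
transitivity (\sum_(e in edges A) F e).
  rewrite /F -big_mkcondr /=.
  have [ijE|] := boolP ((i, j) \in edges A).
    rewrite (big_pred1 (i, j)) // => e /=.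
    by rewrite andbC; case: eqP => // ->; rewrite ijE.
  (* A pair [(i, j)] outside the edge set has weight zero. *)
  rewrite !inE /= neij ltij andbT negbK => /eqP ->.
  by rewrite big1.
rewrite big_enum_val mxE; apply: eq_bigr => k _; rewrite !mxE /F.
have := enum_valP k; move: (enum_val k) => e; rewrite inE => /andP[_ lte].
have := both_ends_eq ltij lte; case: (e =P (i, j)) => [->|_].
  by move=> /andP[-> ->] /=; rewrite -expr2 sqr_sqrtr.
by case: (_ || _) => /= [->|_]; rewrite ?mulr0 ?mul0r.
Qed.

Lemma edge_factor_mul (R : realType) (n : nat) (A : 'M[R]_n) (i j : 'I_n) :
  symmetric_mx A -> nonneg_mx A -> i != j ->
  A i j = (edge_factor A *m (edge_factor A)^T) i j.
Proof.
move=> symA A_ge0; rewrite neq_ltn => /orP[ltij|ltji].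
  exact: edge_factor_mul_lt.
have symH : (edge_factor A *m (edge_factor A)^T)^T
          = edge_factor A *m (edge_factor A)^T by rewrite trmx_mul trmxK.
by rewrite -[in LHS]symA mxE -symH [RHS]mxE; exact: edge_factor_mul_lt.
Qed.

Theorem mainTheorem2 (R : realType) (n : nat) (A : 'M[R]_n)
    (A_sym : symmetric_mx A) (A_ge0 : nonneg_mx A) :
  let K := half_offdiag A in
  [/\ (K <= (n * (n - 1))./2)%N,
      (forall i j : 'I_n, i != j -> 0 < A i j) -> K = (n * (n - 1))./2 &
      exists (k : nat) (H : 'M[R]_(n, k)),
        [/\ (k <= K)%N,
            nonneg_mx H &
            forall i j : 'I_n, i != j -> A i j = (H *m H^T) i j]].
Proof.
move=> K; split.
- rewrite /K /half_offdiag -card_offdiag half_leq //.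
  exact/subset_leq_card/offdiag_support_sub.
- move=> A_gt0; rewrite /K /half_offdiag -card_offdiag.
  congr (_./2); apply: eq_card => -[i j]; rewrite !inE /=.
  by have [//|neij] := eqVneq i j; rewrite gt_eqF ?A_gt0.
- exists #|edges A|, (edge_factor A); split.
  + exact: card_edges_le.
  + by move=> i k; rewrite mxE /=; case: ifP => // _; exact: sqrtr_ge0.
  + by move=> i j neij; exact: edge_factor_mul.
Qed.
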